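(* Let $\mathbb{H}$ be a real or complex Hilbert space, let $A\in\mathbb{B}(\mathbb{H})$ be a nonzero positive operator with closed range $R(A)$, and let $T\in\mathbb{B}_{A^{1/2}}(\mathbb{H})$ be $A$-compact with $\|T\|_A\neq 0$. Then the following are equivalent: (i) $T$ is $A$-smooth. (ii) There exists $x_0\in\mathbb{H}$ with $\|x_0\|_A=1$ such that $M_A(T)\cap R(A)=\{\mu x_0:|\mu|=1\}$.
   Context: $\mathbb{B}(\mathbb{H})$ is the set of bounded linear operators on the Hilbert space $(\mathbb{H},\langle\cdot,\cdot\rangle)$; $\mu$ denotes a scalar. A positive operator $A$ is a self-adjoint operator with $\langle Ax,x\rangle\ge 0$ for all $x$. It induces the semi-inner product $\langle x,y\rangle_A=\langle Ax,y\rangle$ and the semi-norm $\|x\|_A=\sqrt{\langle x,x\rangle_A}=\|A^{1/2}x\|$. $\mathbb{B}_{A^{1/2}}(\mathbb{H})$ is the set of $A$-bounded operators, i.e. those $T\in\mathbb{B}(\mathbb{H})$ for which there is $c>0$ with $\|Tx\|_A\le c\|x\|_A$ for all $x\in\mathbb{H}$; for such $T$, $\|T\|_A=\sup\{\|Tx\|_A:\|x\|_A=1\}$ and $M_A(T)=\{x\in\mathbb{H}:\|x\|_A=1,\ \|Tx\|_A=\|T\|_A\}$. $T\in\mathbb{B}(\mathbb{H})$ is $A$-compact if for every sequence $\{x_n\}$ bounded in $(\mathbb{H},\|\cdot\|_A)$, the sequence $\{Tx_n\}$ has a subsequence converging in $(\mathbb{H},\|\cdot\|_A)$. For $T,S\in\mathbb{B}_{A^{1/2}}(\mathbb{H})$,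 $T\perp_A^B S$ means $\|T+\lambda S\|_A\ge\|T\|_A$ for all scalars $\lambda$. An operator $T\in\mathbb{B}_{A^{1/2}}(\mathbb{H})$ with $\|T\|_A\neq 0$ is called $A$-smooth if for all $S_1,S_2\in\mathbb{B}_{A^{1/2}}(\mathbb{H})$, $T\perp_A^B S_1$ and $T\perp_A^B S_2$ imply $T\perp_A^B S_1+S_2$. *)

(* Defs.v *)
From HB Require Import structures.
From mathcomp Require Import all_boot all_order all_algebra.
From mathcomp Require Import complex.
From mathcomp Require Import boolp classical_sets reals topology normedtype.
From mathcomp Require Import sequences.

Set Implicit Arguments.
Unset Strict Implicit.
Unset Printing Implicit Defensive.

Import Order.TTheory GRing.Theory Num.Theory.
Import numFieldNormedType.Exports.

Local Open Scope classical_set_scope.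
Local Open Scope ring_scope.

(* A single development covers real and complex Hilbert spaces: the scalar field
   is R or R[i], with conjugation and real part accordingly. *)
Variant scalar_kind := RealScalars | ComplexScalars.

Definition scalar_field (R : realType) (k : scalar_kind) : numFieldType :=
  match k with
  | RealScalars => R
  | ComplexScalars => R[i]
  end.

Definition scalar_conj (R : realType) (k : scalar_kind) :
    {rmorphism scalar_field R k -> scalar_field R k} :=
  match k return {rmorphism scalar_field R k -> scalar_field R k} with
  | RealScalars => idfun
  | ComplexScalars => @conjc R
  end.

Definition scalar_re (R : realType) (k : scalar_kind) : scalar_field R k -> R :=
  match k return scalar_field R k -> R with
  | RealScalars => id
  | ComplexScalars => @complex.Re R
  end.

Section SemiHilbertian.
Variables (R : realType) (k : scalar_kind).
Variable H : completeNormedModType (scalar_field R k).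
(* sesquilinear: linear in the first argument, conjugate-linear in the second *)
Variable ip : {dot H for scalar_conj R k}.

(* The norm of the Banach space H comes from the inner product, so that the
   pair (H, ip) is a Hilbert space. *)
Definition norm_of_inner_product := forall x : H, `|x| ^+ 2 = ip x x.

(* The order on R[i] makes 0 <= z say that z is real and nonnegative. *)
Definition positive_operator (A : {linear H -> H}) :=
  [/\ continuous A,
      forall x y, ip (A x) y = ip x (A y) &
      forall x, 0 <= ip (A x) x].

Variable A : {linear H -> H}.

Definition A_inner (x y : H) : scalar_field R k := ip (A x) y.

(* For positive A, A_inner x x is a nonnegative real scalar; scalar_re only moves
   it to R, where square roots and suprema are taken. *)
Definition A_seminorm (x : H) : R := Num.sqrt (scalar_re (A_inner x x)).

Definition A_bounded (T : {linear H -> H}) :=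
  continuous T /\
  exists2 c : R, 0 < c & forall x, A_seminorm (T x) <= c * A_seminorm x.

(* sup is 0 on an empty or unbounded set; for nonzero positive A and A-bounded T
   the set is nonempty and bounded. *)
Definition A_opnorm (T : H -> H) : R :=
  sup [set A_seminorm (T x) | x in [set x | A_seminorm x = 1]].

Definition A_norm_attainment (T : H -> H) : set H :=
  [set x | A_seminorm x = 1 /\ A_seminorm (T x) = A_opnorm T].

Definition A_compact (T : {linear H -> H}) :=
  continuous T /\
  forall x : nat -> H,
    (exists M : R, forall n, A_seminorm (x n) <= M) ->
    exists phi : nat -> nat, {homo phi : m n / (m < n)%N} /\
    exists y : H, A_seminorm (T (x (phi n)) - y) @[n --> \oo] --> (0 : R).

Definition A_birkhoff_orthogonal (T S : H -> H) :=
  forall lambda : scalar_field R k, A_opnorm T <= A_opnorm (T \+ lambda \*: S).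

Definition A_smooth (T : {linear H -> H}) :=
  [/\ A_bounded T, A_opnorm T != 0 &
      forall S1 S2 : {linear H -> H}, A_bounded S1 -> A_bounded S2 ->
        A_birkhoff_orthogonal T S1 -> A_birkhoff_orthogonal T S2 ->
        A_birkhoff_orthogonal T (S1 \+ S2)].

End SemiHilbertian.

(* Main.v *)
Require Import Defs.
From HB Require Import structures.
From mathcomp Require Import all_boot all_order all_algebra.
From mathcomp Require Import complex.
From mathcomp Require Import boolp classical_sets reals topology normedtype.
From mathcomp Require Import sequences.
From mathcomp Require Import ring lra.

Set Implicit Arguments.
Unset Strict Implicit.
Unset Printing Implicit Defensive.

Import Order.TTheory GRing.Theory Num.Theory.
Import numFieldNormedType.Exports.

Local Open Scope classical_set_scope.
Local Open Scope ring_scope.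

(** Write [p] for the seminorm of [A] and [M] for the operator seminorm of [T].

    Everything rests on the structure of the set of attainment of [M]. The
    parallelogram law shows that the vectors with [p (T x) = M * p x] form a
    subspace ([attained_sub]). It also shows that a sequence of unit vectors
    with [p (T (x n))] tending to [M] has a convergent subsequence: [T] is
    compact, so one may assume that [T (x n)] is Cauchy; then
    [M * p (x m + x n) >= p (T (x m) + T (x n))] is close to [2 * M], so
    [p (x m + x n)] is close to 2 and [p (x m - x n)] is close to 0. The seminorm is complete because the range of [A] is
    closed ([seminorm_complete]): if [x] is Cauchy for [p], then [A \o x] is
    Cauchy for the norm and converges to some [A z], from which
    [p (x n - z)] tends to 0; projecting [z] orthogonally onto the range changes
    it by an element of the kernel of [A], so the limit can be taken in the
    range. Thus a maximizing sequence subconverges to a vector of the range at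
    which [M] is attained ([maximizing_cvg]).

    If [M] is attained in the range only at the unit multiples of [x0], then
    [T] is orthogonal to [S] exactly when [T x0] is orthogonal to [S x0], a
    condition that is additive in [S]. For the direction that is not
    immediate, choose near-maximizers of [T + (lam / n) S] with an error of
    order [1 / n ^ 2]. They form a maximizing sequence for [T], and expanding
    the square shows that the real part of the product of [T x] and [lam S x]
    is at least of order [- 1 / n] along it. In the limit it is nonnegative at a
    vector of attainment ([orthogonal_direction]), and it does not depend on
    which multiple of [x0] this vector is.

    Conversely, if [M] is attained in the range at two vectors that are not
    multiples of each other by a scalar of modulus 1, then, the vectors of
    attainment spanning a subspace, it is attained at two orthogonal unit
    vectors [x] and [y]. Let [S1] be the rank-one operator
    [z |-> <z, x> T x] and [S2 = T - S1]. Since [S1 y = 0] and [S2 x = 0], the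
    operator [T] is orthogonal to both, but not to their sum, which is [T]
    itself ([not_smooth_of_orthogonal]). *)

(** * Real and complex scalars *)

Section Scalars.
Variables (R : realType) (k : scalar_kind).
Local Notation K := (scalar_field R k).
Local Notation re := (@scalar_re R k).
Local Notation conj := (@scalar_conj R k).

Definition of_real : R -> K :=
  match k return R -> scalar_field R k with
  | RealScalars => id
  | ComplexScalars => real_complex R
  end.

Lemma reD : {morph re : z w / z + w}.
Proof. by case: k => // -[? ?] [? ?]. Qed.
Lemma reN : {morph re : z / - z}.
Proof. by case: k => // -[? ?]. Qed.
Lemma reB : {morph re : z w / z - w}.
Proof. by move=> z w; rewrite reD reN. Qed.

Lemma of_realK : cancel of_real re.
Proof. by rewrite /of_real; case: k. Qed.

Lemma re_conj z : re (conj z) = re z.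
Proof. by move: z; case: k => // -[? ?]. Qed.

Lemma re_of_realM r z : re (of_real r * z) = r * re z.
Proof. by move: z; rewrite /of_real; case: k => //= -[a b] /=; rewrite mul0r subr0. Qed.

Lemma conj_of_real r : conj (of_real r) = of_real r.
Proof. by rewrite /of_real; case: k => //=; rewrite oppr0. Qed.

Lemma re_ge0 z : 0 <= z -> 0 <= re z.
Proof. by move: z; case: k => //= z; rewrite lecE => /andP[]. Qed.

Lemma re_le z w : z <= w -> re z <= re w.
Proof. by move=> zw; rewrite -subr_ge0 -reB re_ge0 ?subr_ge0. Qed.

Lemma of_real0 : of_real 0 = 0.
Proof. by rewrite /of_real; case: k. Qed.
Lemma of_real1 : of_real 1 = 1.
Proof. by rewrite /of_real; case: k. Qed.
Lemma of_realB : {morph of_real : r s / r - s}.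
Proof. by rewrite /of_real; case: k => // r s; exact: rmorphB. Qed.
Lemma of_realM : {morph of_real : r s / r * s}.
Proof. by rewrite /of_real; case: k => // r s; exact: rmorphM. Qed.
Lemma of_real2 : of_real 2 = 2.
Proof. by rewrite /of_real; case: k => //; exact: rmorph_nat. Qed.

Lemma of_real_ge0 r : (0 <= of_real r) = (0 <= r).
Proof. by rewrite /of_real; case: k => //=; rewrite lecR. Qed.

Lemma of_real_gt0 r : (0 < of_real r) = (0 < r).
Proof. by rewrite /of_real; case: k => //=; rewrite ltcR. Qed.

Lemma of_real_le r s : (of_real r <= of_real s) = (r <= s).
Proof. by rewrite -subr_ge0 -of_realB of_real_ge0 subr_ge0. Qed.
Lemma of_real_lt r s : (of_real r < of_real s) = (r < s).
Proof. by rewrite -subr_gt0 -of_realB of_real_gt0 subr_gt0. Qed.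

Lemma ge0_of_real z : 0 <= z -> z = of_real (re z).
Proof.
by rewrite /of_real; move: z; case: k => //= -[a b]; rewrite lecE /= => /andP[/eqP ->].
Qed.

Lemma normK_conj z : `|z| ^+ 2 = z * conj z.
Proof.
move: z; case: k => /= z; first by rewrite real_normK ?num_real// expr2.
by rewrite sqr_normc.
Qed.
End Scalars.

(** * The semi-inner product of a positive operator *)

Section Form.
Variables (R : realType) (k : scalar_kind).
Local Notation K := (scalar_field R k).
Local Notation re := (@scalar_re R k).
Local Notation conj := (@scalar_conj R k).
Variable H : completeNormedModType K.
Variable ip : {dot H for scalar_conj R k}.
Variable P : {linear H -> H}.

(** The real part of the semi-inner product is a real symmetric bilinear form with
    the same seminorm, so most of the argument can ignore whether the scalars
    are complex. *)
Definition re_inner (x y : H) : R := re (A_inner ip P x y).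

Local Notation b := re_inner.
Local Notation p := (A_seminorm ip P).

Lemma innerDl x y z : A_inner ip P (x + y) z = A_inner ip P x z + A_inner ip P y z.
Proof. by rewrite /A_inner linearD linearDl. Qed.
Lemma innerBl x y z : A_inner ip P (x - y) z = A_inner ip P x z - A_inner ip P y z.
Proof. by rewrite /A_inner linearB linearBl. Qed.
Lemma innerZl a x y : A_inner ip P (a *: x) y = a * A_inner ip P x y.
Proof. by rewrite /A_inner linearZZ linearZl_LR. Qed.
Lemma innerDr x y z : A_inner ip P x (y + z) = A_inner ip P x y + A_inner ip P x z.
Proof. by rewrite /A_inner linearDr. Qed.
Lemma innerBr x y z : A_inner ip P x (y - z) = A_inner ip P x y - A_inner ip P x z.
Proof. by rewrite /A_inner linearBr. Qed.
Lemma innerZr a x y : A_inner ip P x (a *: y) = conj a * A_inner ip P x y.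
Proof. by rewrite /A_inner linearZr_LR. Qed.

Lemma re_innerDl x y z : b (x + y) z = b x z + b y z.
Proof. by rewrite /re_inner innerDl reD. Qed.
Lemma re_innerBl x y z : b (x - y) z = b x z - b y z.
Proof. by rewrite /re_inner innerBl reB. Qed.
Lemma re_innerNl x y : b (- x) y = - b x y.
Proof. by rewrite /re_inner /A_inner (raddfN P) linearNl reN. Qed.
Lemma re_innerDr x y z : b x (y + z) = b x y + b x z.
Proof. by rewrite /re_inner innerDr reD. Qed.
Lemma re_innerBr x y z : b x (y - z) = b x y - b x z.
Proof. by rewrite /re_inner innerBr reB. Qed.
Lemma re_innerZl r x y : b (of_real k r *: x) y = r * b x y.
Proof. by rewrite /re_inner innerZl re_of_realM. Qed.
Lemma re_innerZr r x y : b x (of_real k r *: y) = r * b x y.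
Proof. by rewrite /re_inner innerZr conj_of_real re_of_realM. Qed.

Hypothesis P_pos : positive_operator ip P.

Lemma inner_conj x y : A_inner ip P x y = conj (A_inner ip P y x).
Proof.
case: P_pos => _ P_sym _.
by rewrite /A_inner P_sym; rewrite hermC expr0 mul1r.
Qed.

Lemma re_innerC x y : b x y = b y x.
Proof. by rewrite /re_inner inner_conj re_conj. Qed.

Lemma re_inner_ge0 x : 0 <= b x x.
Proof. by case: P_pos => _ _ P_ge0; apply/re_ge0/P_ge0. Qed.

Lemma seminorm_ge0 x : 0 <= p x.
Proof. exact: sqrtr_ge0. Qed.

Lemma seminorm_sqr x : p x ^+ 2 = b x x.
Proof. by rewrite sqr_sqrtr // re_inner_ge0. Qed.

Lemma inner_seminorm x : A_inner ip P x x = of_real k (p x ^+ 2).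
Proof. by rewrite seminorm_sqr; apply: ge0_of_real; case: P_pos => _ _; apply. Qed.

Lemma seminormZ a x : p (a *: x) = re `|a| * p x.
Proof.
apply/eqP; rewrite -(@eqrXn2 _ 2) ?mulr_ge0 ?seminorm_ge0 ?re_ge0 //.
rewrite exprMn !seminorm_sqr /re_inner innerZl innerZr mulrA -normK_conj.
rewrite [`|a|]ge0_of_real // expr2 -mulrA !re_of_realM of_realK.
by rewrite mulrA -expr2.
Qed.

Lemma seminormZ_real r x : 0 <= r -> p (of_real k r *: x) = r * p x.
Proof. by move=> r0; rewrite seminormZ ger0_norm ?of_real_ge0 // of_realK. Qed.

Lemma seminormN x : p (- x) = p x.
Proof. by rewrite /A_seminorm /A_inner linearNr (raddfN P) linearNl opprK. Qed.

Lemma seminormB x y : p (x - y) = p (y - x).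
Proof. by rewrite -seminormN opprB. Qed.

Lemma seminormD_sqr x y : p (x + y) ^+ 2 = p x ^+ 2 + 2 * b x y + p y ^+ 2.
Proof.
by rewrite !seminorm_sqr re_innerDl !re_innerDr (re_innerC y x); ring.
Qed.

Lemma seminormB_sqr x y : p (x - y) ^+ 2 = p x ^+ 2 - 2 * b x y + p y ^+ 2.
Proof.
by rewrite !seminorm_sqr re_innerBl !re_innerBr (re_innerC y x); ring.
Qed.

Lemma parallelogram x y :
  p (x + y) ^+ 2 + p (x - y) ^+ 2 = 2 * p x ^+ 2 + 2 * p y ^+ 2.
Proof. by rewrite seminormD_sqr seminormB_sqr; ring. Qed.

(** The quadratic polynomial [t |-> p (x - t y) ^ 2] is affine in [t] when [p y = 0];
    being nonnegative, it is constant. *)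
Lemma re_inner_null x y : p y = 0 -> b x y = 0.
Proof.
move=> y0; apply/eqP/negP => /negP bxy.
(* this value of t makes the affine function equal to -1 *)
have := sqr_ge0 (p (x - of_real k ((p x ^+ 2 + 1) / (2 * b x y)) *: y)).
rewrite seminormB_sqr seminormZ y0 mulr0 re_innerZr.
suff -> : 2 * ((p x ^+ 2 + 1) / (2 * b x y) * b x y) = p x ^+ 2 + 1 by lra.
by field.
Qed.

(** Cauchy-Schwarz inequality, obtained by expanding the square of the seminorm of
    [p y x - p x y]. *)
Lemma re_inner_le x y : b x y <= p x * p y.
Proof.
have [x0|x0] := eqVneq (p x) 0; first by rewrite re_innerC re_inner_null // x0 mul0r.
have [y0|y0] := eqVneq (p y) 0; first by rewrite re_inner_null // y0 mulr0.
have px : 0 < p x by rewrite lt_def x0 seminorm_ge0.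
have py : 0 < p y by rewrite lt_def y0 seminorm_ge0.
have := sqr_ge0 (p (of_real k (p y) *: x - of_real k (p x) *: y)).
rewrite seminormB_sqr re_innerZl re_innerZr.
rewrite !seminormZ_real ?seminorm_ge0 // => h.
by rewrite -(ler_pM2l (mulr_gt0 px py)); lra.
Qed.

Lemma ler_seminormD x y : p (x + y) <= p x + p y.
Proof.
rewrite -(@ler_pXn2r _ 2) ?nnegrE ?addr_ge0 ?seminorm_ge0 //.
by rewrite seminormD_sqr; have := re_inner_le x y; lra.
Qed.

Lemma ler_seminorm_dist x y : p x <= p y + p (x - y).
Proof. by rewrite -{1}[x](subrKC y) ler_seminormD. Qed.

(** Bessel inequality for one unit vector: it bounds the modulus of a complex
    product, where the Cauchy-Schwarz inequality above only bounds a real part. *)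
Lemma norm_inner_le x e : p e = 1 -> re `|A_inner ip P x e| <= p x.
Proof.
move=> e1; set c := A_inner ip P x e.
have ee : A_inner ip P e e = 1.
  by rewrite inner_seminorm e1 expr1n of_real1.
have := re_inner_ge0 (x - c *: e).
rewrite /re_inner innerBl !innerBr !innerZl !innerZr (inner_conj e x) -/c ee.
rewrite mulr1 subrr subr0 [conj c * c]mulrC -normK_conj [`|c|]ge0_of_real // expr2.
rewrite reB re_of_realM !of_realK -/(re_inner _ _) -seminorm_sqr -expr2 subr_ge0.
by rewrite ler_pXn2r ?nnegrE ?seminorm_ge0 ?re_ge0.
Qed.

End Form.

(** * Completeness of the seminorm *)

Section SeminormConvergence.
Variables (R : realType) (k : scalar_kind).
Local Notation K := (scalar_field R k).
Variable H : completeNormedModType K.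
Variable ip : {dot H for scalar_conj R k}.
Variable P : {linear H -> H}.
Hypothesis P_pos : positive_operator ip P.
Local Notation p := (A_seminorm ip P).

Definition seminorm_cauchy (x : nat -> H) :=
  forall e : R, 0 < e -> exists N, forall m n, (N <= m)%N -> (N <= n)%N ->
    p (x m - x n) < e.

Lemma seminorm_cvg0P (x : nat -> H) :
  (forall e : R, 0 < e -> \forall n \near \oo, p (x n) < e) <->
  p (x n) @[n --> \oo] --> (0 : R).
Proof.
split=> [h|/cvgr0Pnorm_lt h e e0].
  apply/cvgr0Pnorm_lt => e e0; near=> n.
  rewrite ger0_norm ?seminorm_ge0 //; near: n; exact: h.
near=> n; rewrite -[p _]ger0_norm ?seminorm_ge0 //; near: n; exact: h.
Unshelve. all: by end_near. Qed.

Lemma seminorm_cvg_le (u : nat -> R) (x : nat -> H) :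
  (forall n, p (x n) <= u n) -> u n @[n --> \oo] --> (0 : R) ->
  p (x n) @[n --> \oo] --> (0 : R).
Proof.
move=> xu u0; apply: (squeeze_cvgr _ (cvg_cst 0) u0).
by near=> n; rewrite seminorm_ge0 xu.
Unshelve. all: by end_near. Qed.

Lemma seminorm_cvg (x : nat -> H) z :
  p (x n - z) @[n --> \oo] --> (0 : R) -> p (x n) @[n --> \oo] --> p z.
Proof.
move=> /seminorm_cvg0P h; apply/cvgrPdist_lt => e e0; near=> n.
have := ler_seminorm_dist P_pos z (x n); have := ler_seminorm_dist P_pos (x n) z.
rewrite (seminormB ip P z).
have : p (x n - z) < e by near: n; exact: h.
by rewrite ltr_norml => *; apply/andP; split; lra.
Unshelve. all: by end_near. Qed.

End SeminormConvergence.

(** The norm of [H] is the seminorm of the identity, so that the results on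
    positive operators apply to it. A constant of its own keeps the terms in
    which it occurs syntactically equal. *)
Definition id_op (K : numFieldType) (H : normedModType K) : {linear H -> H} := idfun.

Section Hilbert.
Variables (R : realType) (k : scalar_kind).
Local Notation K := (scalar_field R k).
Local Notation re := (@scalar_re R k).
Variable H : completeNormedModType K.
Variable ip : {dot H for scalar_conj R k}.
Hypothesis H_hilbert : norm_of_inner_product ip.

Local Notation p0 := (A_seminorm ip (id_op H)).
Local Notation b0 := (re_inner ip (id_op H)).

Lemma id_op_positive : positive_operator ip (id_op H).
Proof.
split=> // [x|x]; first exact: cvg_id.
by rewrite -H_hilbert exprn_ge0.
Qed.

Lemma norm_seminorm x : `|x| = of_real k (p0 x).
Proof.
rewrite /A_seminorm /A_inner /= -H_hilbert [`|x|]ge0_of_real // expr2.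
by rewrite re_of_realM of_realK -expr2 sqrtr_sqr ger0_norm ?re_ge0.
Qed.

Lemma seminorm_idE x : p0 x = re `|x|.
Proof. by rewrite norm_seminorm of_realK. Qed.

Lemma norm_lt_seminorm x (e : R) : (`|x| < of_real k e) = (p0 x < e).
Proof. by rewrite norm_seminorm of_real_lt. Qed.

Lemma hilbert_complete (x : nat -> H) :
  seminorm_cauchy ip (id_op H) x -> exists z : H, x @ \oo --> z.
Proof.
move=> x_cauchy; apply/cvg_ex/cauchy_cvgP/cauchy_exP => e e0.
have re0 : 0 < re e by rewrite -(of_real_gt0 k) -ge0_of_real ?ltW.
have [N xN] := x_cauchy _ re0; exists (x N); exists N => // n /= Nn.
rewrite -ball_normE /= [e]ge0_of_real ?(ltW e0) //.
by rewrite norm_lt_seminorm xN.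
Qed.

Lemma cvg_seminorm (x : nat -> H) z :
  x @ \oo --> z -> p0 (x n - z) @[n --> \oo] --> (0 : R).
Proof.
move=> /cvgrPdist_lt xz; apply/seminorm_cvg0P => e e0.
have e0' : 0 < of_real k e by rewrite of_real_gt0.
near=> n; rewrite -norm_lt_seminorm distrC; near: n; exact: xz.
Unshelve. all: by end_near. Qed.

Lemma continuous_seminorm_le (f : {linear H -> H}) : continuous f ->
  exists2 c : R, 0 < c & forall x, p0 (f x) <= c * p0 x.
Proof.
move=> /linear_bounded_continuous/linear_boundedP/pinfty_ex_gt0[r r0 fr].
exists (re r); first by rewrite -(of_real_gt0 k) -ge0_of_real ?ltW.
move=> x; have /re_le := fr x.
rewrite [r]ge0_of_real ?(ltW r0) // re_of_realM of_realK.
by rewrite !seminorm_idE.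
Qed.

Lemma seminorm_le_continuous (f : {linear H -> H}) (c : R) :
  (forall x, p0 (f x) <= c * p0 x) -> continuous f.
Proof.
move=> fc; apply/linear_bounded_continuous/linear_boundedP.
exists (of_real k c); split.
  have [c0|/ltW c0] := leP 0 c; first by rewrite ger0_real // of_real_ge0.
  by rewrite ler0_real // -(of_real0 R k) of_real_le.
move=> r cr x; apply: le_trans (_ : of_real k c * `|x| <= _); last first.
  by rewrite ler_wpM2r // ltW.
by rewrite [`|f x|]norm_seminorm norm_seminorm -of_realM of_real_le.
Qed.

Section PositiveOperator.
Variable P : {linear H -> H}.
Hypothesis P_pos : positive_operator ip P.
Local Notation p := (A_seminorm ip P).
Local Notation b := (re_inner ip P).

Lemma re_innerE x y : b x y = b0 (P x) y.
Proof. by []. Qed.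

Lemma seminorm_le_norm : exists2 c : R, 0 < c & forall x, p x <= c * p0 x.
Proof.
have [/continuous_seminorm_le[c c0 Pc] _ _] := P_pos.
(* p x ^ 2 <= c |x|^2, and c <= (c + 1)^2 dispenses with a square root of c *)
exists (c + 1) => [|x]; first lra.
rewrite -(@ler_pXn2r _ 2) ?nnegrE ?mulr_ge0 ?seminorm_ge0 //; last lra.
rewrite seminorm_sqr // re_innerE (le_trans (re_inner_le id_op_positive _ _)) //.
rewrite exprMn; have := Pc x; have := @seminorm_ge0 _ _ _ ip (id_op H) x.
move: (p0 x) (p0 (P x)) => u v u0 vu; nra.
Qed.

(** [|P x|^2 = <x, P x>_P <= p x * p (P x) <= c * p x * |P x|]. *)
Lemma norm_le_seminorm : exists2 c : R, 0 < c & forall x, p0 (P x) <= c * p x.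
Proof.
have [c c0 pc] := seminorm_le_norm; exists c => // x.
have [->|Px0] := eqVneq (p0 (P x)) 0.
  by rewrite mulr_ge0 ?seminorm_ge0 // ltW.
have Px_gt0 : 0 < p0 (P x) by rewrite lt_def Px0 seminorm_ge0.
rewrite -(ler_pM2r Px_gt0) -expr2 (seminorm_sqr id_op_positive).
rewrite -[X in X <= _]/(b x (P x)) (le_trans (re_inner_le P_pos _ _)) //.
rewrite [c * _]mulrC -mulrA ler_wpM2l ?seminorm_ge0 //.
Qed.

Lemma seminorm_eq0 x : p x = 0 <-> P x = 0.
Proof.
split=> [px|Px]; last by rewrite /A_seminorm /A_inner Px linear0l -(of_real0 R k) of_realK sqrtr0.
have [c _ /(_ x)] := norm_le_seminorm; rewrite px mulr0 => Px.
apply/eqP; rewrite -normr_eq0 norm_seminorm.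
have -> : p0 (P x) = 0 by apply/eqP; rewrite eq_le Px seminorm_ge0.
by rewrite of_real0.
Qed.

Lemma exists_unit : (exists x, P x != 0) -> exists x, p x = 1.
Proof.
move=> [x Px]; have px0 : p x != 0 by apply: contra_neq Px => /seminorm_eq0.
exists (of_real k (p x)^-1 *: x); rewrite seminormZ_real ?invr_ge0 ?seminorm_ge0 //.
by rewrite mulVf.
Qed.

Hypothesis P_closed : closed (range P).

(** [P w] is the orthogonal projection of [z] onto the closed range of [P], that
    is, the nearest point; it is the limit of a minimizing sequence, which is
    Cauchy by the parallelogram law. *)
Lemma closed_range_projection z : exists w, P (z - P w) = 0.
Proof.
pose S := [set p0 (z - P w) ^+ 2 | w in [set: H]].
have S_inf : has_inf S.
  split; first by exists (p0 (z - P 0) ^+ 2), 0.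
  by exists 0 => _ [w _ <-]; rewrite sqr_ge0.
pose d := inf S.
have d_le w : d <= p0 (z - P w) ^+ 2 by apply: (ge_inf S_inf.2); exists w.
have /choice[w wP] (n : nat) : exists w, p0 (z - P w) ^+ 2 < d + n.+1%:R^-1.
  have n0 : 0 < (n.+1%:R^-1 : R) by rewrite invr_gt0.
  by have [_ [w _ <-] ?] := inf_adherent n0 S_inf; exists w.
(* the midpoint of two points of the range is again at squared distance at
   least d from z *)
have w_cauchy : seminorm_cauchy ip (id_op H) (P \o w).
  move=> e e0.
  have e2 : 0 < e ^+ 2 / 4 by rewrite divr_gt0 ?exprn_gt0.
  have [N _ /= N_lt] := cvgr_lt _ (@cvg_harmonic R) _ e2.
  exists N => m n Nm Nn.
  rewrite -(@ltr_pXn2r _ 2) ?nnegrE ?seminorm_ge0 ?(ltW e0) //.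
  have := parallelogram id_op_positive (z - P (w n)) (z - P (w m)).
  set s := p0 (_ + _); set t := p0 (z - P (w n) - (z - P (w m))) => h.
  rewrite (_ : p0 _ = t); last first.
    by rewrite /t /=; congr A_seminorm; rewrite opprB [RHS]addrC addrA subrK.
  have s4 : s ^+ 2 = 4 * p0 (z - P (of_real k 2^-1 *: (w m + w n))) ^+ 2.
    rewrite /s (_ : _ + _ = of_real k 2 *: (z - P (of_real k 2^-1 *: (w m + w n)))).
      by rewrite (seminormZ_real id_op_positive) ?ler0n //; ring.
    have half : of_real k 2 * of_real k (2^-1 : R) = 1.
      by rewrite -of_realM divff ?pnatr_eq0 // of_real1.
    rewrite linearZZ linearD scalerBr scalerA half scale1r of_real2.
    by rewrite scaler_nat mulr2n opprD addrACA [- _ - _]addrC.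
  have key (s2 t2 a b c E i j : R) : s2 + t2 = 2 * a + 2 * b -> s2 = 4 * c ->
    d <= c -> a < d + j -> b < d + i -> j < E / 4 -> i < E / 4 -> t2 < E by lra.
  exact: (key _ _ _ _ _ _ _ _ h s4 (d_le _) (wP n) (wP m) (N_lt n Nn) (N_lt m Nm)).
have [y wy] := hilbert_complete w_cauchy.
have [v _ vy] : range P y.
  by apply: (closed_cvg _ P_closed _ _ wy); near=> n; exists (w n).
exists v; have {wy} : p0 (z - P (w n)) @[n --> \oo] --> p0 (z - P v).
  apply: (seminorm_cvg id_op_positive); apply: seminorm_cvg_le (cvg_seminorm wy) => n.
  have -> : z - P (w n) - (z - P v) = y - P (w n).
    by rewrite vy opprB [LHS]addrC addrA subrK.
  by rewrite seminormB.
move=> wv; have {}wv : p0 (z - P v) ^+ 2 <= d.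
  have cv : p0 (z - P (w n)) ^+ 2 - n.+1%:R^-1 @[n --> \oo] --> p0 (z - P v) ^+ 2 - 0.
    apply: cvgB; last exact: cvg_harmonic.
    by rewrite expr2; apply: cvgM.
  rewrite -[_ ^+ 2]subr0; apply: (cvgr_to_le cv).
  by near=> n; rewrite lerBlDr ltW.
(* moving the nearest point by t P u, with u = z - P v, changes the squared
   distance by - 2 t |P u|^2 + O(t^2), so P u = 0 *)
set u := z - P v in wv *; apply/eqP; rewrite -normr_eq0 norm_seminorm.
suff -> : p0 (P u) = 0 by rewrite of_real0.
apply/eqP; rewrite -sqrf_eq0 eq_le sqr_ge0 andbT leNgt; apply/negP => a0.
set a := p0 (P u) ^+ 2 in a0; set c := p0 (P (P u)) ^+ 2.
have c0 : 0 <= c by exact: sqr_ge0.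
pose t := a / (c + 1).
have := d_le (v + of_real k t *: P u).
rewrite linearD linearZZ opprD addrA -/u (seminormB_sqr id_op_positive).
rewrite re_innerZr.
have -> : b0 u (P (P u)) = a.
  by rewrite /a (seminorm_sqr id_op_positive) (re_innerC id_op_positive); case: P_pos => _ Ps _;
   rewrite /re_inner /A_inner /= -Ps.
have t0 : 0 < t by rewrite divr_gt0 //; lra.
rewrite (seminormZ_real id_op_positive) ?(ltW t0) // exprMn -/c.
have : t * (c + 1) = a by rewrite /t divfK // gt_eqF //; lra.
nra.
Unshelve. all: by end_near. Qed.

(** The limit [z] of [x] is found from the limit [P z] of [P \o x]. With [N] fixed,
    [p (x n - z) ^ 2 = <P (x n - z), x N - z> + <x n - z, x n - x N>_P], where
    the first term tends to 0 with [n] and the second is at most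
    [p (x n - z) * p (x n - x N)]. *)
Lemma seminorm_complete (x : nat -> H) : seminorm_cauchy ip P x ->
  exists w, p (x n - P w) @[n --> \oo] --> (0 : R).
Proof.
move=> x_cauchy.
have [c c0 Pc] := norm_le_seminorm.
have [y xy] : exists y : H, (P \o x) @ \oo --> y.
  apply: hilbert_complete => e e0.
  have [N xN] := x_cauchy (e / c) (divr_gt0 e0 c0).
  exists N => m n Nm Nn; rewrite /= -linearB (le_lt_trans (Pc _)) //.
  by rewrite mulrC -ltr_pdivlMr // xN.
have [z _ zy] : range P y.
  by apply: (closed_cvg _ P_closed _ _ xy); near=> n; exists (x n).
have [w zw] := closed_range_projection z; exists w.
apply/seminorm_cvg0P => e e0.
have e2 : 0 < e / 2 by lra.
have [N xN] := x_cauchy _ e2.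
pose C := p0 (x N - z) + 1.
have C0 : 0 < C by have := @seminorm_ge0 _ _ _ ip (id_op H) (x N - z); rewrite /C; lra.
near=> n.
have le_z : p (x n - P w) <= p (x n - z).
  have -> : x n - P w = (x n - z) + (z - P w) by rewrite addrA subrK.
  by rewrite (le_trans (ler_seminormD P_pos _ _)) // (seminorm_eq0 (z - P w)).2 // addr0.
apply: (le_lt_trans le_z); rewrite ltNge; apply/negP => xe.
have small : p0 (P (x n) - y) < e ^+ 2 / 2 / C.
  near: n; have /seminorm_cvg0P := cvg_seminorm xy; apply.
  by rewrite !divr_gt0 // exprn_gt0.
have /xN xnN : (N <= n)%N by near: n; exists N.
have {}xnN := xnN N (leqnn N).
have xe_sqr : p (x n - z) ^+ 2 =
    b (x n - z) (x N - z) + b (x n - z) (x n - x N).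
  by rewrite seminorm_sqr // -re_innerDr [x N - z + _]addrC addrA subrK.
have b1 : b (x n - z) (x N - z) <= p0 (P (x n) - y) * p0 (x N - z).
  by rewrite -zy -linearB re_innerE re_inner_le //; exact: id_op_positive.
have b2 := re_inner_le P_pos (x n - z) (x n - x N).
have C_ge : p0 (x N - z) <= C by rewrite lerDl.
have key (X Y D E B1 B2 : R) : X ^+ 2 = B1 + B2 -> B1 <= D * E -> B2 <= X * Y ->
    Y < e / 2 -> e <= X -> 0 <= D -> E <= C -> D * C < e ^+ 2 / 2 -> False.
  by move=> *; nra.
apply: (key _ _ _ _ _ _ xe_sqr b1 b2 xnN xe _ C_ge); first exact: seminorm_ge0.
by rewrite -ltr_pdivlMr.
Unshelve. all: by end_near. Qed.

End PositiveOperator.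
End Hilbert.

(** * The operator seminorm and vectors of attainment *)

Definition rank_one (R : realType) (k : scalar_kind)
    (H : completeNormedModType (scalar_field R k)) (ip : {dot H for scalar_conj R k})
    (P : {linear H -> H}) (e v : H) (x : H) : H := A_inner ip P x e *: v.

Lemma rank_one_is_linear (R : realType) (k : scalar_kind)
    (H : completeNormedModType (scalar_field R k)) (ip : {dot H for scalar_conj R k})
    (P : {linear H -> H}) (e v : H) : linear (rank_one ip P e v).
Proof. by move=> a x y; rewrite /rank_one innerDl innerZl scalerDl scalerA. Qed.

HB.instance Definition _ (R : realType) (k : scalar_kind)
    (H : completeNormedModType (scalar_field R k)) (ip : {dot H for scalar_conj R k})
    (P : {linear H -> H}) (e v : H) :=
  GRing.isLinear.Build (scalar_field R k) H H *:%R (rank_one ip P e v)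
    (rank_one_is_linear ip P e v).

Section Operators.
Variables (R : realType) (k : scalar_kind).
Local Notation K := (scalar_field R k).
Local Notation re := (@scalar_re R k).
Variable H : completeNormedModType K.
Variable ip : {dot H for scalar_conj R k}.
Hypothesis H_hilbert : norm_of_inner_product ip.
Variable A : {linear H -> H}.
Hypothesis A_neq0 : exists x, A x != 0.
Hypothesis A_pos : positive_operator ip A.

Local Notation p := (A_seminorm ip A).
Local Notation b := (re_inner ip A).
Local Notation opnorm := (A_opnorm ip A).
Local Notation attained := (A_norm_attainment ip A).

Section Opnorm.
Variables (f : H -> H) (c : R).
Hypothesis f_le : forall x, p (f x) <= c * p x.

Lemma le_opnorm x : p x = 1 -> p (f x) <= opnorm f.
Proof.
move=> x1; apply: ub_le_sup; last by exists x.
by exists c => _ [y /= y1 <-]; have := f_le y; rewrite y1 mulr1.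
Qed.

Lemma opnorm_le (d : R) : (forall x, p x = 1 -> p (f x) <= d) -> opnorm f <= d.
Proof.
move=> fd; have [x x1] := exists_unit H_hilbert A_pos A_neq0.
apply: ge_sup; first by exists (p (f x)), x.
by move=> _ [y /= y1 <-]; apply: fd.
Qed.

Lemma opnorm_approx (e : R) : 0 < e ->
  exists2 x, p x = 1 & opnorm f - e < p (f x).
Proof.
move=> e0; have [x x1] := exists_unit H_hilbert A_pos A_neq0.
have [|_ [y /= y1 <-] ?] := sup_adherent e0 (_ : has_sup [set p (f x) | x in [set x | p x = 1]]).
  split; first by exists (p (f x)), x.
  by exists c => _ [y /= y1 <-]; have := f_le y; rewrite y1 mulr1.
by exists y.
Qed.

End Opnorm.

Section LinearOpnorm.
Variable T : {linear H -> H}.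
Hypothesis T_bounded : A_bounded ip A T.
Local Notation M := (opnorm T).

Lemma A_bounded_le : exists c : R, forall x, p (T x) <= c * p x.
Proof. by have [_ [c _ ?]] := T_bounded; exists c. Qed.

Lemma seminorm_opnorm x : p (T x) <= M * p x.
Proof.
have [c Tc] := A_bounded_le.
have [x0|x0] := eqVneq (p x) 0.
  by rewrite x0 mulr0; have := Tc x; rewrite x0 mulr0.
have px : 0 < p x by rewrite lt_def x0 seminorm_ge0.
have := @le_opnorm T c Tc (of_real k (p x)^-1 *: x).
rewrite linearZZ !(seminormZ_real A_pos) ?invr_ge0 ?seminorm_ge0 // mulVf // => /(_ erefl).
by rewrite ler_pdivrMl // mulrC.
Qed.

Lemma opnorm_ge0 : 0 <= M.
Proof.
have [x x1] := exists_unit H_hilbert A_pos A_neq0.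
by have := seminorm_opnorm x; rewrite x1 mulr1; apply: le_trans (seminorm_ge0 _ _ _).
Qed.

(** In the parallelogram laws for [x], [y] and for [T x], [T y], the two terms on the
    left for [T] are at most [M ^ 2] times those for [x] and [y], while the sums
    are in that ratio. *)
Lemma attained_sub x y : p (T x) = M * p x -> p (T y) = M * p y ->
  p (T (x - y)) = M * p (x - y).
Proof.
move=> Tx Ty; apply/eqP; rewrite eq_le seminorm_opnorm /=.
rewrite -(@ler_pXn2r _ 2) ?nnegrE ?mulr_ge0 ?seminorm_ge0 ?opnorm_ge0 // exprMn.
have := parallelogram A_pos (T x) (T y); rewrite -linearD -linearB Tx Ty.
have := parallelogram A_pos x y.
have : p (T (x + y)) ^+ 2 <= M ^+ 2 * p (x + y) ^+ 2.
  by rewrite -exprMn ler_pXn2r ?nnegrE ?mulr_ge0 ?seminorm_ge0 ?opnorm_ge0 ?seminorm_opnorm.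
have key (m s t Ts Tt u v : R) : Ts <= m ^+ 2 * s -> s + t = 2 * u ^+ 2 + 2 * v ^+ 2 ->
  Ts + Tt = 2 * (m * u) ^+ 2 + 2 * (m * v) ^+ 2 -> m ^+ 2 * t <= Tt.
  move=> h st hT; have -> : Tt = m ^+ 2 * (s + t) - Ts by rewrite st; lra.
  lra.
exact: key.
Qed.

(** The cross term in the square of [p (T x + lam S x)] is nonnegative, so this
    seminorm is at least [p (T x)], which is the operator seminorm of [T]. *)
Lemma orthogonal_of_attained (S : H -> H) (c : R) x :
  (forall y, p (S y) <= c * p y) -> attained T x ->
  (forall lam : K, 0 <= b (T x) (lam *: S x)) -> A_birkhoff_orthogonal ip A T S.
Proof.
move=> Sc [x1 Tx] TS lam; have [d Td] := A_bounded_le.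
have TlS y : p ((T \+ lam \*: S) y) <= (d + re `|lam| * c) * p y.
  rewrite (le_trans (ler_seminormD A_pos _ _)) // (seminormZ A_pos) mulrDl lerD // -mulrA.
  by rewrite ler_wpM2l // re_ge0.
apply: le_trans (le_opnorm TlS x1).
rewrite -Tx -(@ler_pXn2r _ 2) ?nnegrE ?seminorm_ge0 //= (seminormD_sqr A_pos).
by have := TS lam; have := sqr_ge0 (p (lam *: S x)); lra.
Qed.

Hypothesis A_closed : closed (range A).
Hypothesis T_compact : A_compact ip A T.
Hypothesis T_neq0 : M != 0.

Lemma opnorm_gt0 : 0 < M.
Proof. by rewrite lt_def T_neq0 opnorm_ge0. Qed.

(** The subsequence is the one along which [T \o x] converges; there the
    parallelogram law makes [x] Cauchy, since
    [M * p (x m + x n) >= p (T (x m) + T (x n))], which tends to [2 * M]. *)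
Lemma maximizing_cvg (x : nat -> H) : (forall n, p (x n) = 1) ->
  p (T (x n)) @[n --> \oo] --> M ->
  exists2 phi : nat -> nat, (forall n, (n <= phi n)%N) &
  exists2 w, attained T (A w) & p (x (phi n) - A w) @[n --> \oo] --> (0 : R).
Proof.
move=> x1 Tx; have [_ /(_ x)] := T_compact.
case=> [|phi [phi_mono [y Ty]]]; first by exists 1 => n; rewrite x1.
have phi_ge n : (n <= phi n)%N.
  by elim: n => // n IHn; apply: leq_ltn_trans IHn _; apply: phi_mono.
exists phi => //.
have {}Tx : p (T (x (phi n))) @[n --> \oo] --> M.
  apply: cvg_comp Tx => S [N _ NS]; exists N => // n /= Nn.
  by apply: NS; apply: leq_trans Nn (phi_ge n).
have My : p y = M.
  exact: cvg_unique _ (seminorm_cvg A_pos Ty) Tx.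
have M0 := opnorm_gt0.
have cauchy : seminorm_cauchy ip A (x \o phi).
  move=> e e0; have e8 : 0 < M * e ^+ 2 / 8 by rewrite divr_gt0 ?mulr_gt0 ?exprn_gt0.
  have /seminorm_cvg0P /(_ _ e8)[N _ NT] := Ty.
  exists N => m n Nm Nn /=; set u := x (phi m); set v := x (phi n).
  rewrite -(@ltr_pXn2r _ 2) ?nnegrE ?seminorm_ge0 ?(ltW e0) //.
  have par := parallelogram A_pos u v.
  have sum_le : 2 * M <= M * p (u + v) + p (T u - y) + p (T v - y).
    have -> : 2 * M = p (y + y).
      have -> : y + y = of_real k 2 *: y by rewrite of_real2 scaler_nat mulr2n.
      by rewrite seminormZ_real ?My.
    apply: le_trans (ler_seminorm_dist A_pos _ (T u + T v)) _.
    rewrite -[leRHS]addrA; apply: lerD; first by rewrite -(linearD T) seminorm_opnorm.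
    rewrite opprD addrACA (le_trans (ler_seminormD A_pos _ _)) //.
    by apply: lerD; rewrite seminormB.
  have key (s t d d' : R) : s ^+ 2 + t = 4 -> 2 * M <= M * s + d + d' ->
      d < M * e ^+ 2 / 8 -> d' < M * e ^+ 2 / 8 -> t < e ^+ 2.
    move=> st sM dlt dlt'.
    have : 2 * M - M * e ^+ 2 / 4 < M * s by lra.
    have -> : 2 * M - M * e ^+ 2 / 4 = M * (2 - e ^+ 2 / 4) by ring.
    by rewrite ltr_pM2l // => ?; have := sqr_ge0 (s - 2); nra.
  apply: (key _ _ _ _ _ sum_le (NT m Nm) (NT n Nn)).
  by rewrite par !x1; ring.
have [w xw] := seminorm_complete H_hilbert A_pos A_closed cauchy.
exists w => //; split.
  have cvg1 : p (x (phi n)) @[n --> \oo] --> (1 : R).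
    have -> : (fun n => p (x (phi n))) = fun=> 1 by apply/funext => n; exact: x1.
    exact: cvg_cst.
  exact: cvg_unique _ (seminorm_cvg A_pos xw) cvg1.
suff TA : p (T (x (phi n))) @[n --> \oo] --> p (T (A w)).
  exact: cvg_unique _ TA Tx.
apply: (seminorm_cvg A_pos).
apply: (seminorm_cvg_le (u := fun n => M * p (x (phi n) - A w))).
  by move=> n; rewrite -linearB seminorm_opnorm.
by rewrite -[0](mulr0 M); apply: cvgMl_tmp.
Qed.

Lemma exists_attained : exists w, attained T (A w).
Proof.
have [c Tc] := A_bounded_le.
have /choice[x xP] (n : nat) : exists x, p x = 1 /\ M - n.+1%:R^-1 < p (T x).
  have n0 : 0 < (n.+1%:R^-1 : R) by rewrite invr_gt0.
  by have [x ? ?] := opnorm_approx Tc n0; exists x.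
have [||phi _ [w ? _]] := @maximizing_cvg x; [by move=> n; case: (xP n)| |by exists w].
have lower : M - n.+1%:R^-1 @[n --> \oo] --> M.
  by rewrite -[M in _ --> M]subr0; apply: cvgB; [exact: cvg_cst | exact: cvg_harmonic].
apply: (squeeze_cvgr _ lower (cvg_cst M)); near=> n; have [x1 xM] := xP n.
by rewrite (ltW xM) (le_trans (seminorm_opnorm _)) // x1 mulr1.
Unshelve. all: by end_near. Qed.

(** Let the unit vector [x n] maximize the seminorm of [T + t n * lam * S] up to
    [t n ^ 2], where [t n] tends to 0. Since the supremum is at least [M], comparing [M ^ 2] with the square of
    [p (T (x n) + t n * lam * S (x n))] gives a lower bound of order [- t n] for
    [b (T (x n)) (lam * S (x n))]. *)
Lemma orthogonal_direction (S : {linear H -> H}) (lam : K) : A_bounded ip A S ->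
  A_birkhoff_orthogonal ip A T S ->
  exists2 w, attained T (A w) & 0 <= b (T (A w)) (lam *: S (A w)).
Proof.
move=> S_bounded TS; have [c Tc] := A_bounded_le.
have [_ [d d0 Sd]] := S_bounded.
pose V x := lam *: S x.
have V_lin x y : V (x - y) = V x - V y by rewrite /V linearB scalerBr.
pose C := re `|lam| * d + 1.
have C0 : 0 < C by rewrite ltr_wpDl // mulr_ge0 ?re_ge0 // ltW.
have VC x : p (V x) <= C * p x.
  rewrite /V (seminormZ A_pos) /C mulrDl mul1r -mulrA ler_wpDr ?seminorm_ge0 //.
  by rewrite ler_wpM2l // re_ge0.
have M0 := opnorm_gt0.
pose t n : R := n.+1%:R^-1.
have t0 n : 0 < t n by rewrite invr_gt0.
have t_cvg : t @ \oo --> (0 : R) by exact: cvg_harmonic.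
have /choice[x xP] (n : nat) :
    exists x, p x = 1 /\ M - t n ^+ 2 < p (T x + of_real k (t n) *: V x).
  have TSc y : p ((T \+ (of_real k (t n) * lam) \*: S) y) <= (c + t n * C) * p y.
    rewrite /= -scalerA (le_trans (ler_seminormD A_pos _ _)) // mulrDl lerD //.
    by rewrite seminormZ_real ?(ltW (t0 n)) // -mulrA ler_wpM2l ?(ltW (t0 n)) ?VC.
  have [y y1 yM] := opnorm_approx TSc (exprn_gt0 2 (t0 n)).
  exists y; split=> //; rewrite /V scalerA; apply: le_lt_trans yM.
  by rewrite lerB.
have x1 n : p (x n) = 1 by case: (xP n).
have TxM n : p (T (x n)) <= M by have := seminorm_opnorm (x n); rewrite x1 mulr1.
have VxC n : p (V (x n)) <= C by have := VC (x n); rewrite x1 mulr1.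
have Tx_cvg : p (T (x n)) @[n --> \oo] --> M.
  have lower : M - t n * t n - t n * C @[n --> \oo] --> M.
    rewrite [X in _ --> X](_ : M = M - 0 * 0 - 0 * C); last by ring.
    apply: cvgB; last exact: cvgMr_tmp.
    by apply: cvgB; [exact: cvg_cst | exact: cvgM].
  apply: (squeeze_cvgr _ lower (cvg_cst M)); near=> n.
  rewrite TxM andbT; have [_] := xP n.
  have := ler_seminormD A_pos (T (x n)) (of_real k (t n) *: V (x n)).
  rewrite seminormZ_real ?(ltW (t0 n)) //.
  have : t n * p (V (x n)) <= t n * C by rewrite ler_wpM2l ?(ltW (t0 n)).
  by rewrite expr2; lra.
have b_ge n : - (t n * (M + C ^+ 2)) <= b (T (x n)) (V (x n)).
  have [_ big] := xP n.
  have := seminormD_sqr A_pos (T (x n)) (of_real k (t n) *: V (x n)).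
  rewrite re_innerZr seminormZ_real ?(ltW (t0 n)) // exprMn.
  have key (q u v s B : R) : 0 < s -> 0 <= u -> u <= M -> 0 <= v -> v <= C -> M - s ^+ 2 < q ->
      q ^+ 2 = u ^+ 2 + 2 * (s * B) + s ^+ 2 * v ^+ 2 -> - (s * (M + C ^+ 2)) <= B.
    move=> s0 u0 uM v0 vC qM qE.
    have u2 : u ^+ 2 <= M ^+ 2 by rewrite ler_pXn2r ?nnegrE ?(ltW M0).
    have v2 : s ^+ 2 * v ^+ 2 <= s ^+ 2 * C ^+ 2.
      by rewrite ler_wpM2l ?sqr_ge0 // ler_pXn2r ?nnegrE ?(ltW C0).
    (* (q - M)^2 >= 0 avoids squaring M - s^2, which may be negative *)
    have q2 : M ^+ 2 - 2 * M * s ^+ 2 <= q ^+ 2.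
      have := sqr_ge0 (q - M).
      have : M * (M - s ^+ 2) <= M * q by rewrite ler_pM2l // ltW.
      lra.
    rewrite -(ler_pM2l s0); have := mulr_ge0 (sqr_ge0 s) (sqr_ge0 C); lra.
  by move=> E; apply: (key _ _ _ _ _ _ _ _ _ _ big E); rewrite ?seminorm_ge0.
have [phi phi_ge [w Tw xw]] := maximizing_cvg x1 Tx_cvg.
exists w => //; rewrite -/(V (A w)).
pose r n := p (x (phi n) - A w).
have lower : - (t (phi n) * (M + C ^+ 2)) - 2 * M * C * r n @[n --> \oo] --> (0 : R).
  have -> : 0 = - (0 * (M + C ^+ 2)) - 2 * M * C * 0 :> R by ring.
  apply: cvgB; last exact: cvgMl_tmp.
  apply: cvgN; apply: cvgMr_tmp.
  apply: cvg_comp t_cvg => S' [N _ NS]; exists N => // n /= Nn.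
  by apply: NS; apply: leq_trans Nn (phi_ge n).
apply: (cvgr_to_le lower); near=> n.
have -> : b (T (A w)) (V (A w)) = b (T (x (phi n))) (V (x (phi n)))
    - b (T (x (phi n) - A w)) (V (x (phi n))) - b (T (A w)) (V (x (phi n) - A w)).
  by rewrite V_lin (linearB T) re_innerBl re_innerBr; ring.
have := b_ge (phi n).
have [w1 TwM] := Tw.
have h1 : b (T (x (phi n) - A w)) (V (x (phi n))) <= M * C * r n.
  apply: le_trans (re_inner_le A_pos _ _) _.
  rewrite mulrAC; apply: ler_pM; rewrite ?seminorm_ge0 ?seminorm_opnorm //.
have h2 : b (T (A w)) (V (x (phi n) - A w)) <= M * C * r n.
  apply: le_trans (re_inner_le A_pos _ _) _; rewrite TwM -mulrA.
  by rewrite ler_pM2l.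
lra.
Unshelve. all: by end_near. Qed.

End LinearOpnorm.
End Operators.

(** * Smoothness *)

Section Smoothness.
Variables (R : realType) (k : scalar_kind).
Local Notation K := (scalar_field R k).
Local Notation re := (@scalar_re R k).
Variable H : completeNormedModType K.
Variable ip : {dot H for scalar_conj R k}.
Hypothesis H_hilbert : norm_of_inner_product ip.
Variable A : {linear H -> H}.
Hypothesis A_neq0 : exists x, A x != 0.
Hypothesis A_pos : positive_operator ip A.

Local Notation p := (A_seminorm ip A).
Local Notation b := (re_inner ip A).
Local Notation opnorm := (A_opnorm ip A).
Local Notation attained := (A_norm_attainment ip A).

Lemma re_inner_phase (mu : K) x y : `|mu| = 1 -> b (mu *: x) (mu *: y) = b x y.
Proof.
by move=> mu1; rewrite /re_inner innerZl innerZr mulrA -normK_conj mu1 expr1n mul1r.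
Qed.

Lemma seminorm_phase (mu : K) x : `|mu| = 1 -> p (mu *: x) = p x.
Proof. by move=> mu1; rewrite seminormZ // mu1 -(of_real1 R k) of_realK mul1r. Qed.

(** A self-adjoint operator is injective on its range:
    [|A v|^2 = <v, A (A v)>]. *)
Lemma range_seminorm_eq0 x : range A x -> p x = 0 -> x = 0.
Proof.
move=> [v _ <-] /(seminorm_eq0 H_hilbert A_pos) AAv.
case: A_pos => _ A_sym _; have := H_hilbert (A v).
by rewrite A_sym AAv linear0r => /eqP; rewrite expf_eq0 normr_eq0 => /eqP.
Qed.

Lemma A_boundedB (S S' : {linear H -> H}) :
  A_bounded ip A S -> A_bounded ip A S' -> A_bounded ip A (S \- S').
Proof.
move=> [Sc [c c0 Sle]] [S'c [c' c'0 S'le]]; split.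
  by move=> x; apply: cvgB; [exact: Sc | exact: S'c].
exists (c + c') => [|x]; first exact: addr_gt0.
by rewrite /= (le_trans (ler_seminormD A_pos _ _)) // seminormN mulrDl lerD.
Qed.

Lemma rank_one_bounded e v : p e = 1 -> A_bounded ip A (rank_one ip A e v).
Proof.
move=> e1; have [c c0 pc] := seminorm_le_norm H_hilbert A_pos; split.
  apply: (@seminorm_le_continuous _ _ _ _ H_hilbert _ (c * A_seminorm ip (id_op H) v)) => x.
  rewrite (seminormZ (id_op_positive H_hilbert)) mulrAC ler_wpM2r ?seminorm_ge0 //.
  exact: le_trans (norm_inner_le A_pos x e1) (pc x).
exists (p v + 1) => [|x]; first by rewrite ltr_wpDl ?seminorm_ge0.
rewrite seminormZ // mulrC mulrDl mul1r ler_wpDr ?seminorm_ge0 //.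
by rewrite ler_wpM2l ?seminorm_ge0 ?norm_inner_le.
Qed.

Variable T : {linear H -> H}.
Hypothesis T_bounded : A_bounded ip A T.
Hypothesis A_closed : closed (range A).
Hypothesis T_compact : A_compact ip A T.
Hypothesis T_neq0 : opnorm T != 0.

Lemma attained_phase (mu : K) x : `|mu| = 1 -> attained T x -> attained T (mu *: x).
Proof. by move=> mu1 [x1 Tx]; split; rewrite ?linearZZ seminorm_phase. Qed.

(** The orthogonality of [T] to [S] only depends on the product of [T x0] with the
    multiples of [S x0], because a common phase leaves the product unchanged. *)
Lemma smooth_of_unique x0 : p x0 = 1 ->
  attained T `&` range A = [set mu *: x0 | mu in [set mu : K | `|mu| = 1]] ->
  A_smooth ip A T.
Proof.
move=> x01 TA; have Tx0 : attained T x0.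
  suff [] : (attained T `&` range A) x0 by [].
  by rewrite TA; exists 1; rewrite /= ?normr1 ?scale1r.
have orth (S : {linear H -> H}) : A_bounded ip A S -> A_birkhoff_orthogonal ip A T S ->
    forall lam : K, 0 <= b (T x0) (lam *: S x0).
  move=> Sb TS lam.
  have [w Tw] := orthogonal_direction H_hilbert A_neq0 A_pos T_bounded A_closed
    T_compact T_neq0 lam Sb TS.
  have : (attained T `&` range A) (A w) by split=> //; exists w.
  rewrite TA => -[mu /= mu1 <-].
  have -> : lam *: S (mu *: x0) = mu *: (lam *: S x0).
    by rewrite (linearZZ S) !scalerA [lam * mu]mulrC.
  by rewrite (linearZZ T) re_inner_phase.
split=> // S1 S2 S1b S2b TS1 TS2.
have [[_ [c1 _ S1le]] [_ [c2 _ S2le]]] := (S1b, S2b).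
apply: (@orthogonal_of_attained _ _ _ _ _ A_pos _ T_bounded _ (c1 + c2) x0) => // [x|lam].
  by rewrite (le_trans (ler_seminormD A_pos _ _)) // mulrDl lerD.
by rewrite /= scalerDr re_innerDr addr_ge0 ?orth.
Qed.

(** [T] is the sum of [S1 = <., x> T x], which vanishes at [y], and of [T - S1],
    which vanishes at [x]. It is orthogonal to both since its seminorm is
    attained at [y] and at [x], but not to itself. *)
Lemma not_smooth_of_orthogonal x y : attained T x -> attained T y ->
  A_inner ip A y x = 0 -> ~ A_smooth ip A T.
Proof.
move=> Tx Ty yx [_ _ T_smooth].
have [x1 TxM] := Tx.
have S1b := rank_one_bounded (T x) x1.
set S1 : {linear H -> H} := rank_one ip A x (T x) in S1b.
have S2b := A_boundedB T_bounded S1b.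
set S2 : {linear H -> H} := T \- S1 in S2b.
have orth (S : {linear H -> H}) z : A_bounded ip A S -> attained T z -> S z = 0 ->
    A_birkhoff_orthogonal ip A T S.
  move=> [_ [c _ Sc]] Tz Sz; apply: (orthogonal_of_attained A_pos T_bounded Sc Tz).
  by move=> lam; rewrite Sz scaler0 /re_inner /A_inner linear0r -(of_real0 R k) of_realK.
have TS1 : A_birkhoff_orthogonal ip A T S1.
  by apply: (orth _ y) => //; rewrite /S1 /= /rank_one yx scale0r.
have TS2 : A_birkhoff_orthogonal ip A T S2.
  apply: (orth _ x) => //.
  by rewrite /S2 /= /rank_one inner_seminorm // x1 expr1n of_real1 scale1r subrr.
have := T_smooth _ _ S1b S2b TS1 TS2 (-1).
apply/negP; rewrite -ltNge.
apply: le_lt_trans (opnorm_gt0 H_hilbert A_neq0 A_pos T_bounded T_neq0).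
apply: (opnorm_le H_hilbert A_neq0 A_pos) => z z1 /=.
rewrite scaleN1r [_ + (T z - _)]addrC subrK subrr.
by rewrite (seminorm_eq0 H_hilbert A_pos 0).2 ?linear0.
Qed.

(** If [y] and [z] are vectors of attainment in the range, so is, up to scaling,
    the component [r] of [y] orthogonal to [z], unless it is zero. *)
Lemma unique_of_smooth : A_smooth ip A T -> exists x0, p x0 = 1 /\
  attained T `&` range A = [set mu *: x0 | mu in [set mu : K | `|mu| = 1]].
Proof.
move=> T_smooth.
have [w Tw] := exists_attained H_hilbert A_neq0 A_pos T_bounded A_closed T_compact T_neq0.
have [z1 TzM] := Tw; move: z1 TzM; set z := A w => z1 TzM; exists z; split=> //.
apply/seteqP; split=> [y [Ty [v _ vy]]|_ [mu /= mu1 <-]]; last first.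
  by split; [exact: attained_phase | exists (mu *: w); rewrite ?linearZZ].
have [y1 TyM] := Ty.
pose c := A_inner ip A y z; pose r := y - c *: z.
have rz : A_inner ip A r z = 0.
  by rewrite /r innerBl innerZl inner_seminorm // z1 expr1n of_real1 mulr1 subrr.
have r_range : range A r by exists (v - c *: w); rewrite // linearB linearZZ vy.
have [r0|r0] := eqVneq (p r) 0.
  have /eqP := range_seminorm_eq0 r_range r0; rewrite subr_eq0 => /eqP yc.
  exists c => //=; move: y1; rewrite yc seminormZ // z1 mulr1 => c1.
  by rewrite [`|c|]ge0_of_real // c1 of_real1.
have r_gt0 : 0 < p r by rewrite lt_def r0 seminorm_ge0.
have TrM : p (T r) = opnorm T * p r.
  apply: (attained_sub H_hilbert A_neq0 A_pos T_bounded); first by rewrite y1 mulr1.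
  by rewrite linearZZ !seminormZ // TzM z1 mulr1 mulrC.
case: (@not_smooth_of_orthogonal z (of_real k (p r)^-1 *: r)) => //.
  have ir : 0 <= (p r)^-1 by rewrite invr_ge0 ltW.
  split; first by rewrite seminormZ_real // mulVf.
  by rewrite linearZZ seminormZ_real // TrM mulrCA mulVf // mulr1.
by rewrite innerZl rz mulr0.
Qed.

End Smoothness.

Theorem theorem2p11 (R : realType) (k : scalar_kind)
    (H : completeNormedModType (scalar_field R k))
    (ip : {dot H for scalar_conj R k})
    (H_hilbert : norm_of_inner_product ip)
    (A : {linear H -> H})
    (A_neq0 : exists x, A x != 0)
    (A_pos : positive_operator ip A)
    (A_closed_range : closed (range A))
    (T : {linear H -> H})
    (T_bounded : A_bounded ip A T)
    (T_compact : A_compact ip A T)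
    (T_norm_neq0 : A_opnorm ip A T != 0) :
  A_smooth ip A T <->
  exists x0 : H, A_seminorm ip A x0 = 1 /\
    A_norm_attainment ip A T `&` range A =
      [set mu *: x0 | mu in [set mu : scalar_field R k | `|mu| = 1]].
Proof.
split=> [|[x0 [x01 TA]]].
  exact: (unique_of_smooth H_hilbert A_neq0 A_pos T_bounded A_closed_range T_compact).
exact: (smooth_of_unique H_hilbert A_neq0 A_pos T_bounded A_closed_range
  T_compact T_norm_neq0 x01 TA).
Qed.
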